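(* Let $L$ be an abelian $n$-Lie algebra of finite dimension $d$. Then $\dim\mathcal{M}^{(c)}(L)=l_d^n(c+1)$. In particular, $\dim\mathcal{M}(L)=l_d^n(2)=\dfrac{1}{2}d(d-1)$.
   Context: An $n$-Lie algebra is a vector space $L$ over a field with an $n$-ary multilinear skew-symmetric operation $[x_1,\ldots,x_n]$ satisfying $[[x_1,\ldots,x_n],y_2,\ldots,y_n]=\sum_{i=1}^n[x_1,\ldots,[x_i,y_2,\ldots,y_n],\ldots,x_n]$; for $n=2$ this is an ordinary Lie algebra. For subalgebras $L_1,\dots,L_n$ of $L$, $[L_1,\dots,L_n]$ is the subalgebra generated by all $[x_1,\dots,x_n]$ with $x_i\in L_i$. The lower central series is $L^1=L$, $L^{i+1}=[L^i,L,\dots,L]$; $L$ is abelian if $L^2=0$. $c$-nilpotent multiplier ($c$ a positive integer): let $0\to R\to F\to L\to 0$ be a free presentation of $L$, that is, an exact sequence with $F$ a free $n$-Lie algebra. Put $\gamma_1(R,F,\dots,F)=R$ and $\gamma_{i+1}(R,F,\dots,F)=[\gamma_i(R,F,\dots,F),F,\dots,F]$. Then $\mathcal{M}^{(c)}(L)=\dfrac{R\cap F^{c+1}}{\gamma_{c+1}(R,F,\ldots,F)}$, and $\mathcal{M}(L)=\mathcal{M}^{(1)}(L)$ is the multiplier of $L$. $l_d^n(w)$ denotes the number of basic commutators of weight $w$ on $d$ letters in the free $n$-Lie algebra $F$ on $d$ generators; the basic commutators of weight $w$ give a basis of $F^w/F^{w+1}$, so $l_d^n(w)=\dim F^w/F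^{w+1}$.
   Formalization: The formula l_d^n(2) = d(d-1)/2 is false for general n (n = 3, d = 2 gives 0, not 1); the formal statement proves l_d^n(2) = C(d,n) for all n ≥ 2, and d(d-1)/2 for n = 2. *)

(* Defs.v *)
From HB Require Import structures.
From mathcomp Require Import all_boot all_order all_algebra all_fingroup.
From mathcomp Require Import mathcomp_extra boolp classical_sets.

Set Implicit Arguments.
Unset Strict Implicit.
Unset Printing Implicit Defensive.

Import GRing.Theory.

Local Open Scope classical_set_scope.
Local Open Scope ring_scope.

Definition upd (n : nat) (T : Type) (x : 'I_n -> T) (i : 'I_n) (a : T) :
  'I_n -> T := fun j => if j == i then a else x j.

(* Skew-symmetry is the vanishing on repeated arguments, so that the case n = 2
   is a Lie algebra in every characteristic; lemma nbr_skew below recovers the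
   sign rule, which is equivalent to it outside characteristic 2.
   In nbr_deriv the tuple (a, y_2, ..., y_n) is upd y i0 a, where i0 is the
   first index; the value of y at i0 is irrelevant. *)
HB.mixin Record isNLieAlgebra (K : fieldType) (n : nat) L
    of GRing.Lmodule K L := {
  nbr : ('I_n -> L) -> L;
  nbr_linear : forall (x : 'I_n -> L) (i : 'I_n) (a : K) (u v : L),
    nbr (upd x i (a *: u + v)) = a *: nbr (upd x i u) + nbr (upd x i v);
  nbr_alt : forall (x : 'I_n -> L) (i j : 'I_n),
    i != j -> x i = x j -> nbr x = 0;
  nbr_deriv : forall (i0 : 'I_n) (x y : 'I_n -> L), i0 = 0%N :> nat ->
    nbr (upd y i0 (nbr x)) =
    \sum_(i < n) nbr (upd x i (nbr (upd y i0 (x i))))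
}.

#[short(type="nLieAlgType")]
HB.structure Definition NLieAlgebra (K : fieldType) (n : nat) :=
  { L of isNLieAlgebra K n L & GRing.Lmodule K L }.

Section Theory.
Variables (K : fieldType) (n : nat).

Lemma nbr_skew (L : nLieAlgType K n) (x : 'I_n -> L) (i j : 'I_n) :
  i != j -> nbr (fun k => x (tperm i j k)) = - nbr x.
Proof.
move=> ij; have ji : j != i by rewrite eq_sym.
have updI (z : 'I_n -> L) k : upd z k (z k) = z.
  by apply/funext => l; rewrite /upd; case: eqP => // ->.
have addl (z : 'I_n -> L) k u v :
    nbr (upd z k (u + v)) = nbr (upd z k u) + nbr (upd z k v).
  by rewrite -[u]scale1r nbr_linear !scale1r.
pose f u v := nbr (upd (upd x i u) j v).
have f0 u : f u u = 0.
  by apply: (@nbr_alt _ _ _ _ i j ij); rewrite /upd eqxx (negPf ij) eqxx.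
have fC u v : upd (upd x i u) j v = upd (upd x j v) i u.
  apply/funext => l; rewrite /upd; case: (eqVneq l j) => [->|//].
  by rewrite (negPf ji).
have fD1 u v w : f (u + v) w = f u w + f v w by rewrite /f !fC addl.
have fD2 u v w : f u (v + w) = f u v + f u w by rewrite /f addl.
have := f0 (x i + x j); rewrite fD1 !fD2 !f0 add0r addr0 => /eqP.
rewrite addrC addr_eq0 => /eqP fN.
have -> : (fun k => x (tperm i j k)) = upd (upd x i (x j)) j (x i).
  apply/funext => l; rewrite /upd; case: tpermP => [->|->|].
  - by rewrite (negPf ij) eqxx.
  - by rewrite eqxx.
  - by move=> /eqP/negPf-> /eqP/negPf->.
rewrite -/(f _ _) fN; congr (- _).
by rewrite /f updI; congr nbr; rewrite updI.
Qed.

Definition nlie_hom (A B : nLieAlgType K n) (f : A -> B) : Prop :=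
  linear f /\ forall x : 'I_n -> A, f (nbr x) = nbr (fun i => f (x i)).

Section Subspaces.
Variable L : nLieAlgType K n.

Definition subspace (U : set L) : Prop :=
  U 0 /\ forall (a : K) (u v : L), U u -> U v -> U (a *: u + v).

Definition subalgebra (U : set L) : Prop :=
  subspace U /\ forall x : 'I_n -> L, (forall i, U (x i)) -> U (nbr x).

Definition br_sets (U : 'I_n -> set L) : set L :=
  smallest subalgebra [set nbr x | x in [set x | forall i, U i (x i)]].

Definition br_left (U : set L) : set L :=
  br_sets (fun i => if i == 0%N :> nat then U else setT).

(* Indexed from 1: gamma_ U 1 = U, and gamma_ U 0 is the junk value U. *)
Definition gamma_ (U : set L) (i : nat) : set L := iter i.-1 br_left U.

Definition lcs (i : nat) : set L := gamma_ setT i.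

Definition nlie_abelian : Prop := lcs 2 = [set 0].

(* dim (U / V) = k: there is a k-tuple of elements of U whose classes form a
   basis of U / V. *)
Definition has_dim_quo (U V : set L) (k : nat) : Prop :=
  [/\ subspace U, subspace V, V `<=` U &
    exists e : 'I_k -> L,
      [/\ forall i, U (e i),
          forall a : 'I_k -> K, V (\sum_i a i *: e i) -> forall i, a i = 0 &
          forall x, U x -> exists a : 'I_k -> K, V (x - \sum_i a i *: e i)]].

Definition has_dim (k : nat) : Prop := has_dim_quo setT [set 0] k.

End Subspaces.
Arguments lcs L i _ : clear implicits.

Definition free_on (X : Type) (F : nLieAlgType K n) (iota : X -> F) : Prop :=
  forall (A : nLieAlgType K n) (f : X -> A),
    exists! phi : F -> A, nlie_hom phi /\ forall x, phi (iota x) = f x.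

Record free_presentation (L : nLieAlgType K n) := FreePresentation {
  fp_gens : Type;
  fp_alg : nLieAlgType K n;
  fp_iota : fp_gens -> fp_alg;
  fp_free : free_on fp_iota;
  fp_map : fp_alg -> L;
  fp_hom : nlie_hom fp_map;
  fp_surj : forall y : L, exists x : fp_alg, fp_map x = y
}.

Definition fp_ker (L : nLieAlgType K n) (P : free_presentation L) :
  set (fp_alg P) := [set x | fp_map x = 0].
Arguments fp_ker {L} P _.

(* dim M^(c)(L) = k, with M^(c)(L) computed from the presentation P. *)
Definition multiplier_has_dim (L : nLieAlgType K n) (P : free_presentation L)
    (c k : nat) : Prop :=
  has_dim_quo (fp_ker P `&` lcs (fp_alg P) c.+1) (gamma_ (fp_ker P) c.+1) k.

End Theory.

Arguments lcs {K n} L i _.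

(* l_d^n(w) = dim F^w / F^{w+1}, for F free on d generators over K; free
   algebras on d generators being isomorphic, at most one k qualifies. *)
Definition basic_comm_count (K : fieldType) (n d w : nat) : nat :=
  xget 0%N [set k | exists (F : nLieAlgType K n) (iota : 'I_d -> F),
    free_on iota /\ has_dim_quo (lcs F w) (lcs F w.+1) k].

(* Main.v *)
Require Import Defs.
From mathcomp Require Import all_boot all_order all_algebra.
From HB Require Import structures.
From mathcomp Require Import all_fingroup generic_quotient.
From mathcomp Require Import boolp classical_sets.

(** Two facts carry the proof.

    The multiplier does not depend on the free presentation.  Given two
    presentations of [L] with kernels [R] and [S], freeness lifts the identity of
    [L] to homomorphisms in both directions, and either composite displaces every
    element by an element of the kernel.  The derivation rule makes brackets
    compatible with weights: [F^p] bracketed with the [q]-th term of the series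
    of [R] lands in its [(p+q)]-th term ([gamma_nbr]).  Hence the composites
    displace [F^(c+1)] by elements of the [(c+1)]-th relative term
    ([hom_gamma_congr]), so the two lifts induce inverse isomorphisms between the
    multipliers ([multiplier_dim_invariant]).

    For abelian [L] of dimension [d] one presentation is explicit: an algebra [F]
    free on [d] generators, mapped to a basis of [L].  Its kernel is [F^2],
    because [F] is spanned by its generators modulo [F^2] and the basis is
    independent.  The relative series of [F^2] is the lower central series
    shifted by one, so the multiplier is [F^(c+1) / F^(c+2)]
    ([free_multiplier]).  As every algebra free on [d] generators serves here, any
    value admitted by the definition of [basic_comm_count] is the dimension
    sought.

    It remains to see that such a value exists and to compute it in weight two.
    A free algebra is obtained from formal terms by identifying those that agree
    in all algebras ([free_alg_free]).  Modulo higher weight, a bracket of weight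
    [w + 1] depends only on the class of weight [w] in its first slot and on the
    linear parts of the others ([lcs_gen_ind]); thus each quotient of consecutive
    terms is spanned by finitely many brackets ([lcs_quo_fin]).  In weight two
    these are the brackets of generators, and alternation leaves one for each
    [n]-element set of generators.  Their independence is read off in the algebra
    [minor_alg] of class two, whose bracket is given by [n]-minors
    ([free_lcs2_dim]). *)

Set Implicit Arguments.
Unset Strict Implicit.
Unset Printing Implicit Defensive.

Import GRing.Theory.

(** * Subspaces and multilinearity of the bracket *)

Section Multilinearity.
Local Open Scope classical_set_scope.
Local Open Scope ring_scope.
Variables (K : fieldType) (n : nat).
Implicit Types L : nLieAlgType K n.

Lemma upd_same (T : Type) (x : 'I_n -> T) i a : upd x i a i = a.
Proof. by rewrite /upd eqxx. Qed.

Lemma upd_other (T : Type) (x : 'I_n -> T) i a j : j != i -> upd x i a j = x j.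
Proof. by rewrite /upd => /negPf->. Qed.

Lemma upd_id (T : Type) (x : 'I_n -> T) i : upd x i (x i) = x.
Proof. by apply/funext => j; rewrite /upd; case: eqP => // ->. Qed.

Lemma subspace_add L (U : set L) u v : subspace U -> U u -> U v -> U (u + v).
Proof. by move=> [_ lU] Uu Uv; rewrite -[u]scale1r; apply: lU. Qed.

Lemma subspace_scale L (U : set L) a u : subspace U -> U u -> U (a *: u).
Proof. by move=> [U0 lU] Uu; rewrite -[_ *: _]addr0; apply: lU. Qed.

Lemma subspace_opp L (U : set L) u : subspace U -> U u -> U (- u).
Proof. by move=> sU Uu; rewrite -scaleN1r; apply: subspace_scale. Qed.

Lemma subspace_sum L (U : set L) (I : finType) (f : I -> L) :
  subspace U -> (forall i, U (f i)) -> U (\sum_i f i).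
Proof.
move=> sU Uf; elim/big_ind: _ => [|u v Uu Uv|i _]; first by case: sU.
- exact: subspace_add.
- exact: Uf.
Qed.

Lemma subspaceI L (U V : set L) :
  subspace U -> subspace V -> subspace (U `&` V).
Proof.
move=> [U0 lU] [V0 lV]; split=> // a u v [Uu Vu] [Uv Vv].
by split; [apply: lU | apply: lV].
Qed.

Lemma linear_packed (A B : lmodType K) (f : A -> B) :
  linear f -> exists g : {linear A -> B}, f = g.
Proof.
move=> lf; pose m := GRing.isLinear.Build _ _ _ _ _ lf.
by pose g : {linear A -> B} := HB.pack f m; exists g.
Qed.

Lemma linear_sub (A B : lmodType K) (f : A -> B) (u v : A) :
  linear f -> f (u - v) = f u - f v.
Proof. by move=> /linear_packed[g ->]; rewrite raddfB. Qed.

Lemma subspace_preim (A : nLieAlgType K n) L (f : A -> L) (W : set L) :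
  linear f -> subspace W -> subspace [set v | W (f v)].
Proof.
move=> lf [W0 lW]; split=> /= [|a u v Wu Wv]; last by rewrite lf; apply: lW.
by have [g ->] := linear_packed lf; rewrite raddf0.
Qed.

Lemma nbr_slot_linear L (x : 'I_n -> L) i :
  linear (fun v => nbr (upd x i v)).
Proof. by move=> a u v; rewrite nbr_linear. Qed.

Lemma nbr_slot0 L (x : 'I_n -> L) i : x i = 0 -> nbr x = 0.
Proof.
have [g gE] := linear_packed (@nbr_slot_linear L x i).
move=> xi0; rewrite -(upd_id x i) xi0.
by have /= -> := congr1 (@^~ 0) gE; rewrite raddf0.
Qed.

Lemma nbr_slotB L (x : 'I_n -> L) i u v :
  nbr (upd x i u) - nbr (upd x i v) = nbr (upd x i (u - v)).
Proof.
have [g gE] := linear_packed (@nbr_slot_linear L x i).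
have gv w : nbr (upd x i w) = g w by rewrite -gE.
by rewrite !gv raddfB.
Qed.

Definition span L (G : set L) : set L := smallest (@subspace K n L) G.

Lemma span_subspace L (G : set L) : subspace (span G).
Proof.
split=> [W [[]] //|a u v Gu Gv W WP].
by case: (WP) => -[_ lW] _; apply: lW; [apply: Gu | apply: Gv].
Qed.

(** A multilinear operation is controlled by spanning sets of its slots:
    replacing the slots one at a time, the vectors allowed in the current slot
    form a subspace. *)
Lemma nbr_span L (W : set L) (G : 'I_n -> set L) :
  subspace W ->
  (forall x : 'I_n -> L, (forall i, G i (x i)) -> W (nbr x)) ->
  forall x : 'I_n -> L, (forall i, span (G i) (x i)) -> W (nbr x).
Proof.
move=> sW GW x Gx.
suff H m : forall x, (forall i : 'I_n, if (i < m)%N then span (G i) (x i)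
    else G i (x i)) -> W (nbr x).
  by apply: (H n) => i; rewrite ltn_ord.
elim: m => [|m IHm] {Gx} {}x Gx; first exact: GW.
have [ltmn|lenm] := ltnP m n; last first.
  apply: IHm => i; have := Gx i.
  by rewrite !(leq_trans (ltn_ord i)) // (leq_trans lenm).
pose k := Ordinal ltmn; rewrite -(upd_id x k).
have := Gx k; rewrite ltnSn.
apply: (@smallest_sub _ _ _ [set v | W (nbr (upd x k v))]).
  exact: (subspace_preim (nbr_slot_linear x k)).
move=> v Gv /=; apply: IHm => i; rewrite /upd; case: eqP => [->|/eqP ik].
  by rewrite ltnn.
have := Gx i; rewrite ltnS leq_eqVlt.
by have /negPf-> : (i != m :> nat) by apply: contraNneq ik => im; apply/eqP/ord_inj.
Qed.

(** Multilinearity again: the difference of two brackets telescopes into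
    brackets in which one slot holds a difference of corresponding arguments. *)
Lemma nbr_congr L (W : set L) (x y : 'I_n -> L) :
  subspace W ->
  (forall (w : 'I_n -> L) i, (forall j, w j = x j \/ w j = y j) ->
     W (nbr (upd w i (x i - y i)))) ->
  W (nbr x - nbr y).
Proof.
move=> sW WP; pose z m (i : 'I_n) := if (i < m)%N then x i else y i.
have -> : x = z n by apply/funext => i; rewrite /z ltn_ord.
suff H m : W (nbr (z m) - nbr y) by apply: H.
elim: m => [|m IHm]; first by rewrite subrr; case: sW.
rewrite -(subrK (nbr (z m)) (nbr (z m.+1))) -addrA; apply: subspace_add => //.
have [ltmn|lenm] := ltnP m n; last first.
  suff -> : z m.+1 = z m by rewrite subrr; case: sW.
  apply/funext => i; rewrite /z !(leq_trans (ltn_ord i)) //.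
  exact: leq_trans lenm _.
pose k := Ordinal ltmn; have zz : z m.+1 = upd (z m) k (x k).
  apply/funext => i; rewrite /upd /z ltnS leq_eqVlt -[m]/(k : nat) -val_eqE /=.
  by case: eqP => // ik; congr x; apply: ord_inj.
have zk : z m k = y k by rewrite /z ltnn.
rewrite zz -{2}(upd_id (z m) k) zk nbr_slotB; apply: WP => j.
by rewrite /z; case: ifP; [left|right].
Qed.

(** The sign rule for transpositions generates the sign rule for all
    permutations. *)
Lemma nbr_perm L (x : 'I_n -> L) (s : {perm 'I_n}) :
  nbr (fun k => x (s k)) = (-1) ^+ s *: nbr x.
Proof.
have [ts -> {s}] := prod_tpermP s.
elim: ts => [|t ts IHts] /= => [_|/andP[tP /IHts{}IHts]].
  by rewrite big_nil odd_perm1 scale1r; congr nbr; apply/funext => k; rewrite perm1.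
rewrite big_cons odd_mul_tperm tP.
pose y l := x ((\prod_(u <- ts) tperm u.1 u.2)%g l).
transitivity (nbr (fun k => y (tperm t.1 t.2 k))).
  by congr nbr; apply/funext => k; rewrite permM.
by rewrite (nbr_skew y tP) IHts signr_addb expr1 mulN1r scaleNr.
Qed.

End Multilinearity.

(** * Lower central series relative to an ideal *)

Section RelativeSeries.
Local Open Scope classical_set_scope.
Local Open Scope ring_scope.
Variables (K : fieldType) (n : nat) (i0 : 'I_n).
Hypothesis i0E : i0 = 0%N :> nat.
Implicit Types L : nLieAlgType K n.

Definition ideal L (U : set L) : Prop :=
  subspace U /\ forall (x : 'I_n -> L) i, U (x i) -> U (nbr x).

Lemma ord_eq0 (i : 'I_n) : (i == 0%N :> nat) = (i == i0).
Proof. by rewrite -i0E. Qed.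

Lemma br_leftE L (U : set L) : br_left U =
  smallest (@subalgebra K n L) [set nbr x | x in [set x | U (x i0)]].
Proof.
rewrite /br_left /br_sets; congr smallest; congr image.
apply/seteqP; split=> x /= Ux; first by have := Ux i0; rewrite i0E.
by move=> i; rewrite ord_eq0; case: eqP => // ->.
Qed.

Lemma br_left_subspace L (U : set L) : subspace (br_left U).
Proof.
split=> [W [[[]]] //|a u v Hu Hv W WP].
by case: (WP) => -[[_ lW] _] _; apply: lW; [apply: Hu | apply: Hv].
Qed.

Lemma br_left_nbr L (U : set L) (x : 'I_n -> L) i :
  U (x i) -> br_left U (nbr x).
Proof.
have H (y : 'I_n -> L) : U (y i0) -> br_left U (nbr y).
  by move=> Uy; rewrite br_leftE => W [_ GW]; apply: GW; exists y.
have [->|ii0] := eqVneq i i0; first exact: H.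
move=> Ux; rewrite -[nbr x]opprK -(nbr_skew x ii0).
apply: subspace_opp (br_left_subspace _) _.
by apply: (H (fun k => x (tperm i i0 k))); rewrite tpermR.
Qed.

Lemma br_left_sub L (U : set L) : ideal U -> br_left U `<=` U.
Proof.
move=> [sU iU]; rewrite br_leftE; apply: smallest_sub.
  by split=> // x /(_ i0); apply: iU.
by move=> _ [x Ux <-]; apply: iU Ux.
Qed.

Lemma br_left_ideal L (U : set L) : ideal U -> ideal (br_left U).
Proof.
move=> iU; split=> [|x i Ux]; first exact: br_left_subspace.
by apply: (br_left_nbr (i := i)); apply: br_left_sub.
Qed.

(** For an ideal the linear span of the brackets is already closed under the
    bracket, hence the generated subalgebra is that span. *)
Lemma br_left_ind L (U W : set L) : ideal U -> subspace W ->
  (forall x : 'I_n -> L, U (x i0) -> W (nbr x)) -> br_left U `<=` W.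
Proof.
move=> [sU iU] sW UW; apply: (@subset_trans _ (U `&` W)); last by move=> ? [].
rewrite br_leftE; apply: smallest_sub.
  split=> [|x /(_ i0)[Ux _]]; first exact: subspaceI.
  by split; [apply: iU Ux | apply: UW].
by move=> _ [x Ux <-]; split; [apply: iU Ux | apply: UW].
Qed.

Lemma gammaS L (U : set L) k : gamma_ U k.+2 = br_left (gamma_ U k.+1).
Proof. by []. Qed.

Lemma gamma_ideal L (U : set L) k : ideal U -> ideal (gamma_ U k.+1).
Proof. by move=> iU; elim: k => // k; rewrite gammaS; apply: br_left_ideal. Qed.

Lemma gamma_sub L (U : set L) k : ideal U -> gamma_ U k.+2 `<=` gamma_ U k.+1.
Proof. by move=> iU; apply: br_left_sub; apply: gamma_ideal. Qed.

Lemma gamma_sub1 L (U : set L) k : ideal U -> gamma_ U k.+1 `<=` U.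
Proof.
move=> iU; elim: k => // k IHk.
exact: subset_trans (gamma_sub iU) IHk.
Qed.

Lemma idealT L : ideal [set: L].
Proof. by []. Qed.

(** The derivation rule moves a bracket in the first slot onto its arguments;
    induction on [p] then gives that brackets are compatible with the weights. *)
Lemma gamma_nbr L (U : set L) : ideal U ->
  forall p q (x : 'I_n -> L) j, j != i0 ->
  lcs L p.+1 (x i0) -> gamma_ U q.+1 (x j) -> gamma_ U (p + q).+2 (nbr x).
Proof.
move=> iU; elim=> [|p IHp] q x j ji0 xi0 xj; first exact: br_left_nbr xj.
rewrite -(upd_id x i0); move: (x i0) xi0; apply: br_left_ind.
- exact/gamma_ideal/idealT.
- apply: (subspace_preim (nbr_slot_linear x i0)).
  exact: br_left_subspace.
move=> z zi0 /=; rewrite nbr_deriv //.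
apply: subspace_sum => [|k]; first exact: br_left_subspace.
have [->|ki0] := eqVneq k i0.
  apply: (br_left_nbr (i := i0)); rewrite upd_same.
  by apply: (IHp _ _ _ ji0); rewrite ?upd_same // upd_other.
rewrite addSnnS; apply: (IHp q.+1 _ _ ki0).
  by rewrite upd_other // eq_sym.
by rewrite upd_same; apply: (br_left_nbr (i := j)); rewrite upd_other.
Qed.

Lemma gamma_lcs2 L k : gamma_ (lcs L 2) k.+1 = lcs L k.+2.
Proof. by rewrite /lcs /gamma_ /= -iterSr. Qed.

Lemma hom_br_left (A B : nLieAlgType K n) (h : A -> B) (U : set A) (V : set B) :
  nlie_hom h -> (forall x, U x -> V (h x)) ->
  forall x, br_left U x -> br_left V (h x).
Proof.
move=> [lh mh] UV; rewrite [br_left U]br_leftE; apply: smallest_sub.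
  split=> [|x Hx] /=; first exact: (subspace_preim lh (br_left_subspace _)).
  rewrite mh => W WP; case: (WP) => -[_ mW] _; apply: mW => i; exact: Hx.
by move=> _ [x Ux <-] /=; rewrite mh; apply: (br_left_nbr (i := i0)); apply: UV.
Qed.

Lemma hom_gamma (A B : nLieAlgType K n) (h : A -> B) (U : set A) (V : set B) k :
  nlie_hom h -> (forall x, U x -> V (h x)) ->
  forall x, gamma_ U k x -> gamma_ V k (h x).
Proof.
rewrite /gamma_ => hh UV; elim: k.-1 => [|m IHm] //=.
exact: hom_br_left.
Qed.

Lemma hom_lcs (A B : nLieAlgType K n) (h : A -> B) k x :
  nlie_hom h -> lcs A k x -> lcs B k (h x).
Proof. by move=> hh; apply: hom_gamma. Qed.

Lemma ker_ideal (A B : nLieAlgType K n) (h : A -> B) :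
  nlie_hom h -> ideal [set x | h x = 0].
Proof.
move=> [lh mh]; split=> [|x i hx /=]; last by rewrite mh; apply: nbr_slot0 hx.
apply: (subspace_preim lh (W := [set 0])).
by split=> // a u v /= -> ->; rewrite scaler0 addr0.
Qed.

(** An endomorphism that is the identity modulo [S] displaces the [k]-th term of
    the lower central series by elements of the [k]-th relative term of [S]: by
    induction, a telescoping summand either has its first slot in the previous
    relative term, or has a first slot of weight [k - 1] and another slot in
    [S]. *)
Lemma hom_gamma_congr L (S : set L) (h : L -> L) : ideal S -> nlie_hom h ->
  (forall x, S (h x - x)) ->
  forall k x, lcs L k.+1 x -> gamma_ S k.+1 (h x - x).
Proof.
move=> iS hh hS; elim=> [x _|k IHk]; first exact: hS.
have sG := br_left_subspace (gamma_ S k.+1).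
have [lh mh] := hh; have [g gE] := linear_packed lh.
apply: br_left_ind => [||x xi0 /=]; first exact/gamma_ideal/idealT.
  apply: (subspace_preim (f := fun x => h x - x)) => // a u v.
  by rewrite gE linearP scalerBr addrACA opprD.
rewrite mh; apply: nbr_congr => // w i wP.
have [->|ii0] := eqVneq i i0.
  by apply: (br_left_nbr (i := i0)); rewrite upd_same; apply: IHk.
rewrite -(addn0 k); apply: (gamma_nbr iS (p := k) (q := 0%N) ii0).
  rewrite upd_other 1?eq_sym //; case: (wP i0) => -> //.
  exact: (hom_lcs (k := k.+1) hh xi0).
by rewrite upd_same; apply: hS.
Qed.

End RelativeSeries.

(** * Bases of quotients *)

Section Quotients.
Local Open Scope classical_set_scope.
Local Open Scope ring_scope.
Variables (K : fieldType) (n : nat).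
Implicit Types L : nLieAlgType K n.

Definition spanned_mod L (V : set L) (I : finType) (e : I -> L) : set L :=
  [set x | exists a : I -> K, V (x - \sum_i a i *: e i)].

Definition indep_mod L (V : set L) (I : finType) (e : I -> L) : Prop :=
  forall a : I -> K, V (\sum_i a i *: e i) -> forall i, a i = 0.

Lemma sum_delta (I : finType) (M : lmodType K) (e : I -> M) i :
  \sum_j (j == i)%:R *: e j = e i.
Proof.
rewrite (bigD1 i) //= eqxx scale1r big1 ?addr0 // => j /negPf->.
by rewrite scale0r.
Qed.

Lemma spanned_mod_subspace L (V : set L) (I : finType) (e : I -> L) :
  subspace V -> subspace (spanned_mod V e).
Proof.
move=> sV; split.
  exists (fun=> 0); rewrite big1 ?subr0; first by case: sV.
  by move=> i _; rewrite scale0r.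
move=> a u v [b Hb] [c Hc]; exists (fun i => a * b i + c i).
have -> : \sum_i (a * b i + c i) *: e i =
    a *: (\sum_i b i *: e i) + \sum_i c i *: e i.
  rewrite scaler_sumr -big_split; apply: eq_bigr => i _ /=.
  by rewrite scalerDl scalerA.
rewrite opprD addrACA -scalerBr; case: sV => _; exact.
Qed.

Lemma spanned_mod_sub L (V : set L) (I : finType) (e : I -> L) :
  V `<=` spanned_mod V e.
Proof.
move=> x Vx; exists (fun=> 0); rewrite big1 ?subr0 // => i _.
by rewrite scale0r.
Qed.

Lemma spanned_mod_gen L (V : set L) (I : finType) (e : I -> L) i :
  subspace V -> spanned_mod V e (e i).
Proof.
by move=> [V0 _]; exists (fun j => (j == i)%:R); rewrite sum_delta subrr.
Qed.

Lemma spanned_mod_span L (V : set L) (I : finType) (e : I -> L) :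
  spanned_mod V e `<=` span (V `|` range e).
Proof.
move=> x [a Va]; have sS := span_subspace (V `|` range e).
rewrite -(subrK (\sum_i a i *: e i) x).
apply: (subspace_add sS); first by move=> W [_]; apply; left.
apply: (subspace_sum sS) => i; apply: (subspace_scale _ sS) => W [_]; apply.
by right; exists i.
Qed.

(** The coordinates of an independent family on a spanning family form a matrix
    with free rows. *)
Lemma indep_spanned_leq L (V : set L) m k (e : 'I_m -> L) (f : 'I_k -> L) :
  subspace V -> indep_mod V e -> (forall i, spanned_mod V f (e i)) -> (m <= k)%N.
Proof.
move=> sV ie fe; have [a aP] := choice fe.
pose A := \matrix_(i < m, j < k) a i j.
suff /eqP <- : row_free A by exact: rank_leq_col.
apply: inj_row_free => v vA0; apply/rowP => i; rewrite mxE.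
apply: (ie (fun i => v 0 i)).
have vaf0 : \sum_i v 0 i *: \sum_j a i j *: f j = 0.
  under eq_bigr => l _ do (rewrite scaler_sumr; under eq_bigr do rewrite scalerA).
  rewrite exchange_big big1 // => j _ /=; rewrite -scaler_suml.
  have := congr1 (fun u : 'rV_k => u 0 j) vA0; rewrite !mxE.
  by under eq_bigr do rewrite mxE; move=> ->; rewrite scale0r.
rewrite -[X in V X]subr0 -[X in _ - X]vaf0 -sumrB; apply: subspace_sum => // l; rewrite -scalerBr.
exact: (subspace_scale _ sV (aP l)).
Qed.

Lemma has_dim_quo_unique L (U V : set L) k m (e : 'I_m -> L) :
  has_dim_quo U V k -> (forall i, U (e i)) -> indep_mod V e ->
  U `<=` spanned_mod V e -> k = m.
Proof.
move=> [sU sV VU [f [Uf indf spf]]] Ue inde spe; apply/eqP.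
rewrite eqn_leq; apply/andP; split.
- by apply: (indep_spanned_leq sV indf (f := e)) => i; apply/spe/Uf.
- by apply: (indep_spanned_leq sV inde (f := f)) => i; apply/spf/Ue.
Qed.

(** A spanning family of minimal size is a basis: a nontrivial relation would
    express one of its members through the others. *)
Lemma spanned_has_dim_quo L (U V : set L) (I : finType) (e : I -> L) :
  subspace U -> subspace V -> V `<=` U -> (forall i, U (e i)) ->
  U `<=` spanned_mod V e -> exists k, has_dim_quo U V k.
Proof.
move=> sU sV VU Ue spe.
pose Q m := `[< exists f : 'I_m -> L,
  (forall i, U (f i)) /\ U `<=` spanned_mod V f >].
have exQ : exists m, Q m.
  exists #|I|; apply/asboolP; exists (fun i => e (enum_val i)); split=> // x.
  move=> /spe[a Va]; exists (fun i => a (enum_val i)).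
  by rewrite (reindex (@enum_val I I)) // in Va; apply: onW_bij; apply: enum_val_bij.
case: (ex_minnP exQ) => m /asboolP[f [Uf spf]] minm.
exists m; split=> //; exists f; split=> // a Va i; apply/eqP/negPn/negP => ai0.
case: m => [|m] in f Uf spf minm a Va i ai0 *; first by case: i {ai0}.
suff /minm : Q m by rewrite ltnn.
apply/asboolP; exists (fun j => f (lift i j)); split=> // x /spf.
have sW := spanned_mod_subspace (fun j => f (lift i j)) sV.
have Wf j : spanned_mod V (fun j => f (lift i j)) (f j).
  have [<-|/unlift_some[k -> _]] := eqVneq i j; last first.
    exact: (spanned_mod_gen (fun j => f (lift i j)) k sV).
  exists (fun k => - (a i)^-1 * a (lift i k)).
  rewrite (bigD1_ord i) //= in Va.
  have -> : f i - \sum_k - (a i)^-1 * a (lift i k) *: f (lift i k) =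
     (a i)^-1 *: (a i *: f i + \sum_k a (lift i k) *: f (lift i k)).
    rewrite scalerDr scalerA mulVf // scale1r -sumrN scaler_sumr; congr (_ + _).
    by apply: eq_bigr => k _; rewrite mulNr scaleNr opprK scalerA.
  exact: subspace_scale.
move=> [b Vb]; rewrite -(subrK (\sum_i b i *: f i) x).
apply: subspace_add => //; first exact: spanned_mod_sub.
by apply: subspace_sum => // j; apply: subspace_scale.
Qed.

(** Two linear maps that are mutually inverse modulo [V] and [V'] carry bases of
    one quotient to bases of the other. *)
Lemma has_dim_quo_transfer (A B : nLieAlgType K n) (U V : set A) (U' V' : set B)
    (h : A -> B) (g : B -> A) k :
  linear h -> linear g -> subspace U' -> subspace V' -> V' `<=` U' ->
  (forall x, U x -> U' (h x)) -> (forall x, V x -> V' (h x)) ->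
  (forall y, U' y -> U (g y)) -> (forall y, V' y -> V (g y)) ->
  (forall x, U x -> V (g (h x) - x)) -> (forall y, U' y -> V' (h (g y) - y)) ->
  has_dim_quo U V k -> has_dim_quo U' V' k.
Proof.
move=> /linear_packed[{}h ->] /linear_packed[{}g ->] sU' sV' VU'.
move=> hU hV gU gV ghV hgV [sU sV VU [e [Ue inde spe]]].
split=> //; exists (fun i => h (e i)); split=> [i|a Va|y Uy]; first exact/hU/Ue.
  apply: inde; rewrite -[X in V X](subrK (g (\sum_i a i *: h (e i)))).
  apply: subspace_add; [by []| |exact: gV].
  rewrite -opprB; apply: subspace_opp => //; rewrite linear_sum -sumrB.
  apply: subspace_sum => // i; rewrite linearZ -scalerBr.
  by apply: subspace_scale => //; apply: ghV.
have [a /hV] := spe _ (gU _ Uy); rewrite linearB linear_sum => Va.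
exists a; rewrite -(subrK (h (g y)) y) -addrA; apply: subspace_add => //.
  by rewrite -opprB; apply: subspace_opp => //; apply: hgV.
by under eq_bigr do rewrite -linearZ.
Qed.

End Quotients.

(** * Invariance of the multiplier *)

Section Invariance.
Local Open Scope classical_set_scope.
Local Open Scope ring_scope.
Variables (K : fieldType) (n : nat) (i0 : 'I_n).
Hypothesis i0E : i0 = 0%N :> nat.
Implicit Types L : nLieAlgType K n.

Lemma nlie_hom_comp (A B C : nLieAlgType K n) (f : A -> B) (g : B -> C) :
  nlie_hom f -> nlie_hom g -> nlie_hom (g \o f).
Proof.
move=> [lf mf] [lg mg]; split=> [a u v|x] /=; first by rewrite lf lg.
by rewrite mf mg.
Qed.

Lemma nlie_hom_id (A : nLieAlgType K n) : nlie_hom (@id A).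
Proof. by []. Qed.

Lemma free_hom_eq (X : Type) (F A : nLieAlgType K n) (iota : X -> F)
    (f g : F -> A) : free_on iota -> nlie_hom f -> nlie_hom g ->
  (forall x, f (iota x) = g (iota x)) -> f = g.
Proof.
move=> fF hf hg fg; have [phi [_ uphi]] := fF A (g \o iota).
by rewrite -[LHS]uphi -?[RHS]uphi.
Qed.

Lemma free_presentation_lift L (P Q : free_presentation L) :
  exists h : fp_alg P -> fp_alg Q,
    nlie_hom h /\ forall x, fp_map (h x) = fp_map x.
Proof.
have [f fE] := choice (fun x : fp_gens P => fp_surj Q (fp_map (fp_iota x))).
have [h [[hh hE] _]] := @fp_free _ _ _ P _ f; exists h; split=> // x.
have := free_hom_eq (@fp_free _ _ _ P) (nlie_hom_comp hh (fp_hom Q)) (fp_hom P).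
by move=> /(_ _)/(congr1 (@^~ x)); apply=> y /=; rewrite hE fE.
Qed.

(** Lifts of the identity of [L] in both directions compose to endomorphisms
    that are the identity modulo the kernels of the presentations, and such
    endomorphisms act trivially on the multiplier. *)
Lemma multiplier_dim_invariant L (P Q : free_presentation L) c k :
  multiplier_has_dim P c k -> multiplier_has_dim Q c k.
Proof.
have kerI (P' : free_presentation L) : ideal (@fp_ker _ _ _ P').
  exact: ker_ideal (fp_hom P').
have endo (P' Q' : free_presentation L) (h : fp_alg P' -> fp_alg Q')
    (g : fp_alg Q' -> fp_alg P') : nlie_hom h -> nlie_hom g ->
    (forall x, fp_map (h x) = fp_map x) -> (forall y, fp_map (g y) = fp_map y) ->
    forall x, (@fp_ker _ _ _ P' `&` lcs (fp_alg P') c.+1) x ->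
    gamma_ (@fp_ker _ _ _ P') c.+1 (g (h x) - x).
  move=> hh hg hE gE x [_ cx].
  have := hom_gamma_congr i0E (kerI P') (nlie_hom_comp hh hg) _ cx; apply=> y.
  by rewrite /fp_ker /= (linear_sub _ _ (proj1 (fp_hom P'))) gE hE subrr.
have [h [hh hE]] := free_presentation_lift P Q.
have [g [hg gE]] := free_presentation_lift Q P.
have kerh x : fp_ker x -> @fp_ker _ _ _ Q (h x) by rewrite /fp_ker /= hE.
have kerg x : fp_ker x -> @fp_ker _ _ _ P (g x) by rewrite /fp_ker /= gE.
apply: (has_dim_quo_transfer (proj1 hh) (proj1 hg)).
- apply: subspaceI; first by case: (kerI Q).
  by case: (gamma_ideal i0E c (@idealT K n (fp_alg Q))).
- by case: (gamma_ideal i0E c (kerI Q)).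
- move=> x cx; split; first exact: (gamma_sub1 i0E (kerI Q) cx).
  exact: (hom_gamma i0E (nlie_hom_id _) (fun _ _ => I) cx).
- by move=> x [kx cx]; split; [apply: kerh | apply: (hom_lcs i0E hh cx)].
- by move=> x; apply: (hom_gamma i0E hh).
- by move=> x [kx cx]; split; [apply: kerg | apply: (hom_lcs i0E hg cx)].
- by move=> x; apply: (hom_gamma i0E hg).
- exact: endo.
- exact: endo.
Qed.

End Invariance.

(** * Free algebras *)

Section FreeAlgebra.
Local Open Scope quotient_scope.
Local Open Scope ring_scope.
Variables (K : fieldType) (n : nat) (X : Type).

Inductive term :=
  | Var of X
  | Zero
  | Add of term & term
  | Scale of K & term
  | Br of 'I_n -> term.

Fixpoint eval (A : nLieAlgType K n) (f : X -> A) (t : term) : A :=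
  match t with
  | Var x => f x
  | Zero => 0
  | Add t u => eval f t + eval f u
  | Scale a t => a *: eval f t
  | Br t => nbr (fun i => eval f (t i))
  end.

HB.instance Definition _ := gen_eqMixin term.
HB.instance Definition _ := gen_choiceMixin term.

(** Terms are identified when they agree under every interpretation, so the laws
    of the quotient are instances of the laws of the algebras interpreting it. *)
Definition term_equiv (t u : term) : bool :=
  `[< forall (A : nLieAlgType K n) (f : X -> A), eval f t = eval f u >].

Lemma term_equiv_rel : equiv_class_of term_equiv.
Proof.
split=> [t|t u|t u v]; first exact/asboolP.
- by apply/asboolP/asboolP => H A f; rewrite H.
- by move=> /asboolP H1 /asboolP H2; apply/asboolP => A f; rewrite H1.
Qed.

Canonical term_equivRel := EquivRelPack term_equiv_rel.

Definition free_alg := {eq_quot term_equiv}.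

HB.instance Definition _ := Choice.on free_alg.

Definition free_class (t : term) : free_alg := \pi_{eq_quot term_equiv} t.

Definition free_eval (A : nLieAlgType K n) (f : X -> A) (x : free_alg) : A :=
  eval f (repr x).

Lemma free_eval_pi (A : nLieAlgType K n) (f : X -> A) (t : term) :
  free_eval f (free_class t) = eval f t.
Proof.
by have /eqmodP/asboolP := reprK (free_class t); apply.
Qed.

Lemma free_classK (x : free_alg) : free_class (repr x) = x.
Proof. exact: reprK. Qed.

Lemma free_eval_inj (x y : free_alg) :
  (forall (A : nLieAlgType K n) (f : X -> A), free_eval f x = free_eval f y) ->
  x = y.
Proof.
by move=> H; rewrite -[x]reprK -[y]reprK; apply/eqmodP/asboolP.
Qed.

Definition free_zero : free_alg := free_class Zero.
Definition free_add (x y : free_alg) : free_alg := free_class (Add (repr x) (repr y)).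
Definition free_scale (a : K) (x : free_alg) : free_alg :=
  free_class (Scale a (repr x)).
Definition free_opp (x : free_alg) : free_alg := free_scale (-1) x.
Definition free_nbr (x : 'I_n -> free_alg) : free_alg :=
  free_class (Br (fun i => repr (x i))).

Section Eval.
Variables (A : nLieAlgType K n) (f : X -> A).

Lemma free_eval_zero : free_eval f free_zero = 0.
Proof. by rewrite free_eval_pi. Qed.

Lemma free_eval_add x y :
  free_eval f (free_add x y) = free_eval f x + free_eval f y.
Proof. by rewrite free_eval_pi. Qed.

Lemma free_eval_scale a x :
  free_eval f (free_scale a x) = a *: free_eval f x.
Proof. by rewrite free_eval_pi. Qed.

Lemma free_eval_opp x : free_eval f (free_opp x) = - free_eval f x.
Proof. by rewrite free_eval_scale scaleN1r. Qed.

Lemma free_eval_nbr x :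
  free_eval f (free_nbr x) = nbr (fun i => free_eval f (x i)).
Proof. by rewrite free_eval_pi. Qed.

Lemma free_eval_upd (x : 'I_n -> free_alg) i a :
  (fun j => free_eval f (upd x i a j)) =
  upd (fun j => free_eval f (x j)) i (free_eval f a).
Proof. by apply/funext => j; rewrite /upd; case: ifP. Qed.

End Eval.

Definition free_evalE :=
  (free_eval_zero, free_eval_opp, free_eval_add, free_eval_scale, free_eval_nbr,
   free_eval_upd).

Fact free_addA : associative free_add.
Proof. by move=> x y z; apply: free_eval_inj => A f; rewrite !free_evalE addrA. Qed.

Fact free_addC : commutative free_add.
Proof. by move=> x y; apply: free_eval_inj => A f; rewrite !free_evalE addrC. Qed.

Fact free_add0 : left_id free_zero free_add.
Proof. by move=> x; apply: free_eval_inj => A f; rewrite !free_evalE add0r. Qed.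

Fact free_addN : left_inverse free_zero free_opp free_add.
Proof. by move=> x; apply: free_eval_inj => A f; rewrite !free_evalE addNr. Qed.

HB.instance Definition _ :=
  GRing.isZmodule.Build free_alg free_addA free_addC free_add0 free_addN.

Fact free_scaleA a b x : free_scale a (free_scale b x) = free_scale (a * b) x.
Proof. by apply: free_eval_inj => A f; rewrite !free_evalE scalerA. Qed.

Fact free_scale1 : left_id 1 free_scale.
Proof. by move=> x; apply: free_eval_inj => A f; rewrite !free_evalE scale1r. Qed.

Fact free_scaleDr : right_distributive free_scale +%R.
Proof.
by move=> a x y; apply: free_eval_inj => A f; rewrite !free_evalE scalerDr.
Qed.

Fact free_scaleDl x : {morph free_scale^~ x : a b / a + b}.
Proof.
by move=> a b; apply: free_eval_inj => A f; rewrite !free_evalE scalerDl.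
Qed.

HB.instance Definition _ := GRing.Zmodule_isLmodule.Build K free_alg
  free_scaleA free_scale1 free_scaleDr free_scaleDl.

Lemma free_eval_linear (A : nLieAlgType K n) (f : X -> A) :
  linear (free_eval f).
Proof. by move=> a x y; rewrite !free_evalE. Qed.

Lemma free_eval_sum (A : nLieAlgType K n) (f : X -> A) (x : 'I_n -> free_alg) :
  free_eval f (\sum_i x i) = \sum_i free_eval f (x i).
Proof.
by have [g ->] := linear_packed (@free_eval_linear A f); rewrite raddf_sum.
Qed.

Fact free_nbr_linear (x : 'I_n -> free_alg) i a u v :
  free_nbr (upd x i (a *: u + v)) =
  a *: free_nbr (upd x i u) + free_nbr (upd x i v).
Proof.
by apply: free_eval_inj => A f; rewrite !free_evalE nbr_linear.
Qed.

Fact free_nbr_alt (x : 'I_n -> free_alg) i j :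
  i != j -> x i = x j -> free_nbr x = 0.
Proof.
move=> ij xij; apply: free_eval_inj => A f.
by rewrite !free_evalE (nbr_alt _ i j) // xij.
Qed.

Fact free_nbr_deriv (i0 : 'I_n) (x y : 'I_n -> free_alg) :
  i0 = 0%N :> nat ->
  free_nbr (upd y i0 (free_nbr x)) =
  \sum_i free_nbr (upd x i (free_nbr (upd y i0 (x i)))).
Proof.
move=> i0E; apply: free_eval_inj => A f.
rewrite free_eval_sum !free_evalE nbr_deriv //.
by apply: eq_bigr => i _; rewrite !free_evalE.
Qed.

HB.instance Definition _ := isNLieAlgebra.Build K n free_alg
  free_nbr_linear free_nbr_alt free_nbr_deriv.

Definition free_gen (x : X) : free_alg := free_class (Var x).

Lemma free_eval_hom (A : nLieAlgType K n) (f : X -> A) :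
  nlie_hom (free_eval f).
Proof. by split; [exact: free_eval_linear | exact: free_eval_nbr]. Qed.

Lemma eval_free_gen (t : term) : eval free_gen t = free_class t.
Proof.
elim: t => [x|//|t IHt u IHu|a t IHt|t IHt] //=.
- rewrite IHt IHu; apply: free_eval_inj => A f.
  by rewrite free_eval_add !free_eval_pi.
- rewrite IHt; apply: free_eval_inj => A f.
  by rewrite free_eval_scale !free_eval_pi.
- apply: free_eval_inj => A f; rewrite free_eval_nbr free_eval_pi /=.
  by congr nbr; apply/funext => i; rewrite IHt free_eval_pi.
Qed.

Lemma free_alg_free : free_on free_gen.
Proof.
move=> A f; exists (free_eval f); split=> [|phi [[lphi mphi] phiE]].
  by split; [exact: free_eval_hom | move=> x; rewrite free_eval_pi].
apply/funext => x; rewrite -[x]free_classK free_eval_pi -eval_free_gen.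
have [g gE] := linear_packed lphi.
elim: (repr x) => [y||t IHt u IHu|a t IHt|t IHt] /=.
- by rewrite phiE.
- by rewrite gE raddf0.
- by rewrite IHt IHu gE raddfD.
- by rewrite IHt gE linearZ.
- by rewrite mphi; congr nbr; apply/funext => i; rewrite IHt.
Qed.

End FreeAlgebra.

(** A free algebra is a retract of the algebra of terms on the same generators,
    so each of its elements is the value of a term. *)
Lemma free_ind (K : fieldType) (n : nat) (X : Type) (F : nLieAlgType K n)
    (iota : X -> F) (U : set F) :
  free_on iota -> subalgebra U -> (forall x, U (iota x)) -> forall x, U x.
Proof.
move=> fF [sU mU] Uiota x.
have [h [[hh hE] _]] := fF _ (@free_gen K n X).
have := free_hom_eq fF (nlie_hom_comp hh (free_eval_hom iota)) (nlie_hom_id F).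
move=> /(_ _)/(congr1 (@^~ x))/= <-; last by move=> y; rewrite hE free_eval_pi.
rewrite /free_eval.
elim: (repr (h x)) => [y||t Ut u Uu|a t Ut|t Ut] //=.
- by case: sU.
- exact: subspace_add.
- exact: subspace_scale.
- exact: mU.
Qed.

(** * The lower central series of a finitely generated free algebra *)

Section FinitelyGenerated.
Local Open Scope classical_set_scope.
Local Open Scope ring_scope.
Variables (K : fieldType) (n d : nat) (i0 : 'I_n).
Hypothesis i0E : i0 = 0%N :> nat.
Implicit Types F L : nLieAlgType K n.

Lemma lcs_subspace F k : subspace (lcs F k.+1).
Proof. by case: (gamma_ideal i0E k (@idealT K n F)). Qed.

Lemma lcs_sub F k : lcs F k.+2 `<=` lcs F k.+1.
Proof. exact: (gamma_sub i0E (@idealT K n F)). Qed.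

Lemma lcs_nbr F k (x : 'I_n -> F) i : lcs F k.+1 (x i) -> lcs F k.+2 (nbr x).
Proof. exact: (br_left_nbr i0E). Qed.

Lemma free_spanned F (j : 'I_d -> F) :
  free_on j -> forall x, spanned_mod (lcs F 2) j x.
Proof.
move=> fF; apply: (free_ind fF) => [|i]; last first.
  exact: (spanned_mod_gen j i (lcs_subspace F 1)).
split=> [|x _]; first exact: (spanned_mod_subspace j (lcs_subspace F 1)).
by apply: spanned_mod_sub; apply: (lcs_nbr (k := 0%N) (i := i0)).
Qed.

(** Modulo weight [w + 3], brackets of weight [w + 2] are controlled by those
    with a representative of the weight [w + 1] quotient in the first slot and
    generators in the others: correcting the first slot by weight [w + 2], or
    another slot by weight 2, changes the bracket by weight [w + 3]. *)
Lemma lcs_gen_ind F (j : 'I_d -> F) w (I : finType) (e : I -> F) (W : set F) :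
  (forall x, spanned_mod (lcs F 2) j x) ->
  (forall u, lcs F w.+1 (e u)) -> lcs F w.+1 `<=` spanned_mod (lcs F w.+2) e ->
  subspace W -> lcs F w.+3 `<=` W ->
  (forall y : 'I_n -> F, range e (y i0) ->
     (forall i, i != i0 -> range j (y i)) -> W (nbr y)) ->
  lcs F w.+2 `<=` W.
Proof.
move=> jF we spe sW W3 Wgen.
apply: (br_left_ind i0E) => //.
  exact: (gamma_ideal i0E w (@idealT K n F)).
move=> x xi0.
pose G i : set F := if i == i0 then lcs F w.+2 `|` range e
                    else lcs F 2 `|` range j.
apply: (nbr_span (G := G)) => //; last first.
  move=> i; rewrite /G; case: eqP => [->|_]; apply: spanned_mod_span => //.
  exact: spe.
move=> {xi0}g gG.
have gi0 : lcs F w.+1 (g i0).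
  have := gG i0; rewrite /G eqxx; case=> [gi0|[u _ <-]]; last exact: we.
  exact: lcs_sub.
have [[i ii0 gi]|noni] := pselect (exists2 i, i != i0 & lcs F 2 (g i)).
  apply: W3; rewrite -(addn1 w).
  exact: (gamma_nbr i0E (@idealT K n F) (p := w) (q := 1%N) ii0).
have := gG i0; rewrite {1}/G eqxx; case=> [gi0w|eu].
  by apply: W3; apply: (lcs_nbr (i := i0)).
apply: Wgen => // i ii0; have := gG i; rewrite /G (negPf ii0); case=> // gi.
by case: noni; exists i.
Qed.

Lemma lcs_quo_fin F (j : 'I_d -> F) :
  (forall x, spanned_mod (lcs F 2) j x) ->
  forall w, exists k, has_dim_quo (lcs F w.+1) (lcs F w.+2) k.
Proof.
move=> jF w.
suff [I [e [we spe]]] : exists (I : finType) (e : I -> F),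
    (forall u, lcs F w.+1 (e u)) /\ lcs F w.+1 `<=` spanned_mod (lcs F w.+2) e.
  have [sU sV] := (lcs_subspace F w, lcs_subspace F w.+1).
  exact: (spanned_has_dim_quo sU sV (@lcs_sub F w) we spe).
elim: w => [|w [I [e [we spe]]]].
  by exists ('I_d : finType), j; split=> // x _; apply: jF.
(* [None] fills the first entry, which [upd] overwrites; no function into ['I_d]
   could do so when [d = 0] *)
pose y (p : I * {ffun 'I_n -> option 'I_d}) : 'I_n -> F :=
  upd (fun i => oapp j 0 (p.2 i)) i0 (e p.1).
exists ((I * {ffun 'I_n -> option 'I_d})%type : finType), (fun p => nbr (y p)).
split=> [p|]; first by apply: (lcs_nbr (i := i0)); rewrite /y upd_same.
have sW := spanned_mod_subspace (fun p => nbr (y p)) (lcs_subspace F w.+2).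
apply: (lcs_gen_ind jF we spe sW); first exact: spanned_mod_sub.
move=> z [u _ uz] jz.
have /choice[s sE] : forall i, exists o, i != i0 -> z i = oapp j 0 o.
  move=> i; have [->|/jz[l _ <-]] := eqVneq i i0; first by exists None.
  by exists (Some l).
have -> : z = y (u, finfun s).
  apply/funext => i; rewrite /y /upd /= ffunE.
  by case: eqP => [->|/eqP/sE].
exact: (spanned_mod_gen (fun p => nbr (y p)) _ (lcs_subspace F w.+2)).
Qed.

(** The multiplier computed from a presentation of the abelian algebra [L] on a
    basis: its kernel is exactly the second term of the lower central series. *)
Lemma free_multiplier L F (j : 'I_d -> F) : nlie_abelian L -> has_dim L d ->
  free_on j -> exists P : free_presentation L, forall c k, (0 < c)%N ->
    has_dim_quo (lcs F c.+1) (lcs F c.+2) k -> multiplier_has_dim P c k.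
Proof.
move=> abL [_ _ _ [b [_ indb spb]]] fF.
have [q [[hq qj] _]] := fF L b.
have [[lq _] [q' q'E]] := (hq, linear_packed (proj1 hq)).
have qsum (a : 'I_d -> K) : q (\sum_i a i *: j i) = \sum_i a i *: b i.
  rewrite q'E linear_sum; apply: eq_bigr => i _.
  by rewrite linearZ -q'E qj.
have surj y : exists x, q x = y.
  have [a /eqP] := spb y I; rewrite subr_eq0 => /eqP ->.
  by exists (\sum_i a i *: j i).
exists (FreePresentation fF hq surj) => c k c0; rewrite /multiplier_has_dim.
have -> : fp_ker (P := FreePresentation fF hq surj) = lcs F 2.
  apply/seteqP; split=> x; rewrite /fp_ker /=; last first.
    by move=> /(hom_lcs i0E hq); rewrite abL.
  have [a xa] := free_spanned fF x; move=> qx.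
  have a0 : forall i, a i = 0.
    apply: indb; have := hom_lcs i0E hq xa.
    rewrite abL /= (linear_sub _ _ lq) qx qsum sub0r => /eqP.
    by rewrite oppr_eq0 => /eqP.
  move: xa; rewrite big1 ?subr0 // => i _; by rewrite a0 scale0r.
rewrite (gamma_lcs2 F c) (_ : _ `&` _ = lcs F c.+1) //.
apply/seteqP; split=> x; first by case.
move=> cx; split=> //; case: c c0 cx => // c _; rewrite -gamma_lcs2.
exact: (gamma_sub1 i0E (gamma_ideal i0E 1 (@idealT K n F))).
Qed.

End FinitelyGenerated.

(** * The quotient of weight two *)

(** When [g] enumerates the [n]-element sets of columns, this is the free
    nilpotent algebra of class 2 on [d] generators: the second component is the
    [n]-th exterior power in coordinates, which are the minors on the columns
    [g s]. *)
Definition minor_alg (K : fieldType) (n d m : nat)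
  (g : 'I_m -> 'I_n -> 'I_d) : Type := ('rV[K]_d * 'rV[K]_m)%type.

Section MinorAlgebra.
Local Open Scope classical_set_scope.
Local Open Scope ring_scope.
Variables (K : fieldType) (n d m : nat) (g : 'I_m -> 'I_n -> 'I_d).

Local Notation M := (minor_alg K g).

HB.instance Definition _ := GRing.Lmodule.copy M ('rV[K]_d * 'rV[K]_m)%type.

Definition minor_mx (x : 'I_n -> M) (s : 'I_m) : 'M[K]_n :=
  \matrix_(i, k) (x i).1 0 (g s k).

Definition minor_nbr (x : 'I_n -> M) : M := (0, \row_s \det (minor_mx x s)).

Lemma minor_nbr0 (x : 'I_n -> M) i : (x i).1 = 0 -> minor_nbr x = 0.
Proof.
move=> xi0; congr pair; apply/rowP => s; rewrite !mxE.
by rewrite (expand_det_row _ i) big1 // => k _; rewrite !mxE xi0 mxE mul0r.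
Qed.

Fact minor_nbr_linear (x : 'I_n -> M) i a u v :
  minor_nbr (upd x i (a *: u + v)) =
  a *: minor_nbr (upd x i u) + minor_nbr (upd x i v).
Proof.
apply: injective_projections => /=; first by rewrite scaler0 addr0.
apply/rowP => s; rewrite !mxE.
rewrite (determinant_multilinear (i0 := i) (b := a) (c := 1)
  (B := minor_mx (upd x i u) s) (C := minor_mx (upd x i v) s)) ?mul1r //.
- by apply/rowP => k; rewrite !mxE !upd_same /= !mxE mul1r.
- by apply/matrixP => k l; rewrite !mxE !upd_other // eq_sym neq_lift.
- by apply/matrixP => k l; rewrite !mxE !upd_other // eq_sym neq_lift.
Qed.

Fact minor_nbr_alt (x : 'I_n -> M) i j :
  i != j -> x i = x j -> minor_nbr x = 0.
Proof.
move=> ij xij; congr pair; apply/rowP => s; rewrite !mxE.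
by apply: (determinant_alternate ij) => k; rewrite !mxE xij.
Qed.

Fact minor_nbr_deriv (i0 : 'I_n) (x y : 'I_n -> M) :
  i0 = 0%N :> nat ->
  minor_nbr (upd y i0 (minor_nbr x)) =
  \sum_i minor_nbr (upd x i (minor_nbr (upd y i0 (x i)))).
Proof.
move=> _; rewrite (@minor_nbr0 _ i0) ?upd_same // big1 // => i _.
by rewrite (@minor_nbr0 _ i) ?upd_same.
Qed.

HB.instance Definition _ := isNLieAlgebra.Build K n M
  minor_nbr_linear minor_nbr_alt minor_nbr_deriv.

Lemma minor_lcs3 (i0 : 'I_n) : i0 = 0%N :> nat -> lcs M 3 `<=` [set 0].
Proof.
move=> i0E; apply: (br_left_ind i0E).
- exact: (gamma_ideal i0E 1 (@idealT K n M)).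
- by split=> // a u v /= -> ->; rewrite scaler0 addr0.
have sub : lcs M 2 `<=` [set x : M | x.1 = 0].
  apply: (br_left_ind i0E) => //; split=> // a u v /= -> ->.
  by rewrite scaler0 addr0.
by move=> x /sub; apply: minor_nbr0.
Qed.

End MinorAlgebra.

Section WeightTwo.
Local Open Scope classical_set_scope.
Local Open Scope ring_scope.
Variables (K : fieldType) (n d : nat) (i0 : 'I_n).
Hypothesis i0E : i0 = 0%N :> nat.

(** Injective tuples with the same image differ by a permutation, so fixed
    enumerations of the [n]-element subsets represent all of them once. *)
Lemma subset_enumeration : exists g : 'I_('C(d, n)) -> 'I_n -> 'I_d,
  [/\ forall s, injective (g s),
      forall s t, (forall i, exists k, g s i = g t k) -> s = t &
      forall f : 'I_n -> 'I_d, injective f ->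
        exists s, forall i, exists k, f i = g s k].
Proof.
pose D := [set A : {set 'I_d} | #|A| == n]%SET.
have DC : #|D| = 'C(d, n) by rewrite card_draws card_ord.
pose S (s : 'I_('C(d, n))) : {set 'I_d} := enum_val (cast_ord (esym DC) s).
have Sn s : #|S s| = n.
  by have := enum_valP (cast_ord (esym DC) s); rewrite inE => /eqP.
pose g s (i : 'I_n) : 'I_d := enum_val (cast_ord (esym (Sn s)) i).
have gS s x : x \in S s -> exists k, x = g s k.
  move=> xS; exists (cast_ord (Sn s) (enum_rank_in xS x)).
  by rewrite /g cast_ordK enum_rankK_in.
exists g; split=> [s i k /enum_val_inj/cast_ord_inj //|s t st|f injf].
  apply: (@cast_ord_inj _ _ (esym DC)); apply: enum_val_inj.
  apply/eqP; rewrite eqEcard -/(S s) -/(S t) !Sn leqnn andbT.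
  by apply/fintype.subsetP => x /gS[i ->]; have [k ->] := st i; apply: enum_valP.
have fD : (f @: [set: 'I_n])%SET \in D.
  by rewrite inE card_imset // cardsT card_ord.
exists (cast_ord DC (enum_rank_in fD (f @: [set: 'I_n])%SET)) => i; apply: gS.
by rewrite /S cast_ordK enum_rankK_in // imset_f.
Qed.

Lemma free_lcs2_dim (F : nLieAlgType K n) (j : 'I_d -> F) k :
  free_on j -> has_dim_quo (lcs F 2) (lcs F 3) k -> k = 'C(d, n).
Proof.
move=> fF dimk.
have [g [injg gst gf]] := subset_enumeration.
apply: (has_dim_quo_unique (e := fun s => nbr (j \o g s)) dimk).
- by move=> s; apply: (lcs_nbr i0E (k := 0%N) (i := i0)).
- (* evaluate a relation in the class 2 model, where the minors of the tuples of
     basis vectors are those of a permuted identity matrix *)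
  move=> a /= Ha t.
  pose b (l : 'I_d) : minor_alg K g := (delta_mx 0 l, 0).
  have [h [[hh hb] _]] := fF _ b.
  have := hom_lcs i0E hh Ha => /(minor_lcs3 i0E) /=.
  have [h' h'E] := linear_packed (proj1 hh).
  rewrite h'E linear_sum => /(congr1 (fun z : minor_alg K g => z.2 0 t)).
  have -> : (\sum_s h' (a s *: nbr (j \o g s))).2 =
      \sum_s a s *: (nbr (b \o g s) : minor_alg K g).2.
    rewrite (raddf_sum snd); apply: eq_bigr => s _.
    rewrite linearZ /= -h'E (proj2 hh); rewrite (_ : (fun i => _) = b \o g s) //.
    by apply/funext => i; rewrite /= hb.
  rewrite summxE /= mxE => <-; rewrite (bigD1 t) //= big1 ?addr0 => [|s st].
    rewrite !mxE (_ : minor_mx _ _ = 1%:M) ?det1 ?mulr1 //.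
    by apply/matrixP => i l; rewrite !mxE eqxx /= (inj_eq (injg t)) eq_sym.
  have [i gi] : exists i, forall l, g s i <> g t l.
    apply: contrapT => no; move/eqP: st; apply; apply: gst => i.
    by apply: contrapT => noi; apply: no; exists i => l gl; apply: noi; exists l.
  rewrite !mxE (expand_det_row _ i) big1 ?mulr0 // => l _.
  by rewrite !mxE eqxx /= (introF eqP (nesym (gi l))) mul0r.
pose W := spanned_mod (lcs F 3) (fun s => nbr (j \o g s)).
have sW : subspace W := spanned_mod_subspace _ (lcs_subspace i0E F 2).
apply: (lcs_gen_ind i0E (e := j) (free_spanned i0E fF)) => //.
- by move=> x _; apply: (free_spanned i0E fF).
- exact: spanned_mod_sub.
move=> y yi0 yj.
have /choice[f fy] : forall i, exists l, j l = y i.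
  move=> i; have [->|/yj[l _ <-]] := eqVneq i i0; last by exists l.
  by case: yi0 => l _ <-; exists l.
have [/injectiveP injf|/injectivePn[i [l il fil]]] := boolP (injectiveb f); last first.
  by rewrite (nbr_alt y i l) -?fy ?fil //; case: sW.
have [s /choice[p fp]] := gf f injf.
have injp : injective p by move=> i l il; apply: injf; rewrite !fp il.
have -> : y = fun i => (j \o g s) (perm injp i).
  by apply/funext => i; rewrite permE /= -fp fy.
rewrite nbr_perm; apply: (subspace_scale _ sW).
exact: (spanned_mod_gen (fun s => nbr (j \o g s)) s (lcs_subspace i0E F 2)).
Qed.

End WeightTwo.

Theorem theorem2p3 (K : fieldType) (n d : nat) (hn : (2 <= n)%N)
    (L : nLieAlgType K n) (habel : nlie_abelian L) (hdim : has_dim L d)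
    (P : free_presentation L) :
  (forall c : nat, (0 < c)%N ->
     multiplier_has_dim P c (basic_comm_count K n d c.+1)) /\
  multiplier_has_dim P 1 (basic_comm_count K n d 2) /\
  basic_comm_count K n d 2 = 'C(d, n) /\
  (n = 2 -> basic_comm_count K n d 2 = ((d * (d - 1)) %/ 2)%N).
Proof.
pose i0 : 'I_n := Ordinal (ltnW hn).
have i0E : i0 = 0 :> nat by [].
have count w : exists (F : nLieAlgType K n) (iota : 'I_d -> F), free_on iota /\
    has_dim_quo (lcs F w.+1) (lcs F w.+2) (basic_comm_count K n d w.+1).
  apply: (@xgetPex _ 0 [set k | exists (F : nLieAlgType K n) (iota : 'I_d -> F),
    free_on iota /\ has_dim_quo (lcs F w.+1) (lcs F w.+2) k]%classic).
  have fF := @free_alg_free K n 'I_d.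
  have [k dimk] := lcs_quo_fin i0E (free_spanned i0E fF) w.
  by exists k, (free_alg K n 'I_d), (@free_gen K n 'I_d).
have main c : (0 < c)%N -> multiplier_has_dim P c (basic_comm_count K n d c.+1).
  move=> c0; have [F [iota [fF dimF]]] := count c.
  have [Q QE] := free_multiplier i0E habel hdim fF.
  exact/(multiplier_dim_invariant i0E P)/QE.
have two : basic_comm_count K n d 2 = 'C(d, n).
  have [F [iota [fF dimF]]] := count 1.
  exact: (free_lcs2_dim i0E fF dimF).
split; [exact: main | split; [exact: main | split=> // n2]].
by rewrite two n2 bin2 -divn2 subn1.
Qed.
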